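(* Suppose $0<l_1<l_2$ and $\delta>0$. Let $\vartheta_i=l_im+\frac{\delta\coth l_i}{4}x$ $(i=1,2)$ and let $\chi=g/f$ with $$f=(\operatorname{csch}l_1\operatorname{csch}l_2)^2\big[(\cosh2l_1\cosh2l_2-1)\cosh2\vartheta_1\cosh2\vartheta_2-\sinh2l_1\sinh2l_2(1+\sinh2\vartheta_1\sinh2\vartheta_2)\big],$$ $$g=\delta(\coth^2l_1-\coth^2l_2)(\coth l_1\cosh2\vartheta_2-\coth l_2\cosh2\vartheta_1).$$ Then, as $m\to\pm\infty$, $\chi$ has the following asymptotic behaviour. (1) ($l_1$-soliton) With $\vartheta_1$ held fixed, as $m\to\pm\infty$ $\chi$ tends to a single-soliton profile (a function of $\vartheta_1$) whose extremum (the unique maximum point of its modulus) lies on the trace $$x(m)=\frac{2}{\delta\coth l_1}\Big(\mp\ln\frac{\sinh(l_2-l_1)}{\sinh(l_1+l_2)}-2l_1m\Big),$$ with amplitude (value of the profile at the extremum) $$\frac{\delta\coth l_1(\coth^2l_1-\coth^2l_2)}{2(\operatorname{csch}l_1\operatorname{csch}l_2)^2\sinh(l_2-l_1)\sinh(l_1+l_2)},$$ speed $-\frac{4l_1}{\delta\coth l_1}$, and phase shift $-\frac{4}{\delta\coth l_1}\ln\frac{\sinh(l_2-l_1)}{\sinh(l_1+l_2)}$. (2) ($l_2$-soliton) With $\vartheta_2$ held fixed, as $m\to\pm\infty$ $\chi$ tends to a single-soliton profile (a function of $\vartheta_2$) whose extremum (the unique maximum point of its modulus) lies on the trace $$x(m)=\frac{2}{\delta\coth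 l_2}\Big(\pm\ln\frac{\sinh(l_2-l_1)}{\sinh(l_1+l_2)}-2l_2m\Big),$$ with amplitude $$\frac{\delta\coth l_2(\coth^2l_2-\coth^2l_1)}{2(\operatorname{csch}l_1\operatorname{csch}l_2)^2\sinh(l_2-l_1)\sinh(l_1+l_2)},$$ speed $-\frac{4l_2}{\delta\coth l_2}$, and phase shift $\frac{4}{\delta\coth l_2}\ln\frac{\sinh(l_2-l_1)}{\sinh(l_1+l_2)}$. In each formula the upper sign refers to $m\to+\infty$ and the lower sign to $m\to-\infty$.
   Context: Here $\chi(x,m)$, $x\in\mathbb{R}$, $m\in\mathbb{Z}$, is the two-soliton solution (together with $\varpi=\partial_xf/f$) of the nonlocal semi-discrete sine-Gordon equation $2(\partial_x\widehat\chi-\partial_x\chi)+(\widehat\chi+\chi)[2(\widehat\varpi-\varpi)-\delta]=0$, $\partial_x\varpi(x,m)=\chi(x,m)\chi(-x,-m)$, where $\widehat F(x,m)=F(x,m+1)$, given by the displayed formula. ''With $\vartheta_i$ held fixed, $m\to\pm\infty$'' means: substitute $x=\frac{4}{\delta\coth l_i}(\vartheta_i-l_im)$ and let $m\to\pm\infty$ for each fixed real $\vartheta_i$. The speed is the slope $dx/dm$ of the trace; the phase shift is the intercept of the trace for $m\to+\infty$ minus the intercept of the trace for $m\to-\infty$. *)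

(* Defs.v *)
From Stdlib Require Import Reals ZArith Lra.
From Coquelicot Require Import Coquelicot.
Open Scope R_scope.

Definition coth (x : R) : R := cosh x / sinh x.
Definition csch (x : R) : R := / sinh x.

Definition theta (delta l x : R) (m : Z) : R :=
  l * IZR m + delta * coth l / 4 * x.

(* The value of [x] at which [theta delta l x m = t]. *)
Definition x_of_theta (delta l t : R) (m : Z) : R :=
  4 / (delta * coth l) * (t - l * IZR m).

Definition two_soliton_f (delta l1 l2 x : R) (m : Z) : R :=
  let t1 := theta delta l1 x m in
  let t2 := theta delta l2 x m in
  (csch l1 * csch l2) ^ 2 *
  ((cosh (2 * l1) * cosh (2 * l2) - 1) * cosh (2 * t1) * cosh (2 * t2)
   - sinh (2 * l1) * sinh (2 * l2) * (1 + sinh (2 * t1) * sinh (2 * t2))).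

Definition two_soliton_g (delta l1 l2 x : R) (m : Z) : R :=
  let t1 := theta delta l1 x m in
  let t2 := theta delta l2 x m in
  delta * (coth l1 ^ 2 - coth l2 ^ 2) *
  (coth l1 * cosh (2 * t2) - coth l2 * cosh (2 * t1)).

Definition two_soliton (delta l1 l2 x : R) (m : Z) : R :=
  two_soliton_g delta l1 l2 x m / two_soliton_f delta l1 l2 x m.

(* The nonlocal semi-discrete sine-Gordon equation. *)
Definition nonlocal_sdsG (delta : R) (chi varpi : R -> Z -> R) : Prop :=
  forall (x : R) (m : Z),
    ex_derive (fun y => chi y m) x /\
    is_derive (fun y => varpi y m) x (chi x m * chi (- x) (- m)%Z) /\
    2 * (Derive (fun y => chi y (m + 1)%Z) x - Derive (fun y => chi y m) x)
    + (chi x (m + 1)%Z + chi x m)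
      * (2 * (varpi x (m + 1)%Z - varpi x m) - delta) = 0.

(* As a function of [t = theta delta l x m], the one-soliton solution with
   parameter [l]; see [one_soliton_sdsG]. *)
Definition one_soliton (delta l t : R) : R :=
  delta * coth l / 2 / cosh (2 * t).

(* The equation is invariant under [chi -> - chi], so both signs occur; a
   profile is moreover considered up to a translation of [t]. *)
Definition single_soliton_profile (delta l : R) (P : R -> R) : Prop :=
  exists e c : R, (e = 1 \/ e = -1) /\
    forall t, P t = e * one_soliton delta l (t - c).

Definition Z_p_infty (A : Z -> Prop) : Prop :=
  exists N : Z, forall m : Z, (N < m)%Z -> A m.
Definition Z_m_infty (A : Z -> Prop) : Prop :=
  exists N : Z, forall m : Z, (m < N)%Z -> A m.

(* [chi] tends pointwise to [P], with [theta delta l x m] held fixed, as [m]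
   goes to infinity along [F]. *)
Definition tends_to_profile (F : (Z -> Prop) -> Prop) (delta l : R)
    (chi : R -> Z -> R) (P : R -> R) : Prop :=
  forall t : R,
    filterlim (fun m : Z => chi (x_of_theta delta l t m) m) F (locally (P t)).

Definition is_extremum (P : R -> R) (t0 : R) : Prop :=
  forall t : R, t <> t0 -> Rabs (P t) < Rabs (P t0).

Definition is_amplitude (P : R -> R) (a : R) : Prop :=
  exists t0 : R, is_extremum P t0 /\ P t0 = a.

Definition is_trace (delta l : R) (P : R -> R) (X : Z -> R) : Prop :=
  forall (x : R) (m : Z), is_extremum P (theta delta l x m) <-> x = X m.

Definition is_line (X : Z -> R) (slope intercept : R) : Prop :=
  forall m : Z, X m = slope * IZR m + intercept.

(* [Xp] and [Xm] are the traces for [m -> +oo] and [m -> -oo]. *)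
Definition soliton_asymptotics (delta l : R) (chi : R -> Z -> R)
    (Xp Xm : Z -> R) (amplitude speed phase_shift : R) : Prop :=
  exists Pp Pm : R -> R,
    (single_soliton_profile delta l Pp /\ single_soliton_profile delta l Pm) /\
    (tends_to_profile Z_p_infty delta l chi Pp /\
     tends_to_profile Z_m_infty delta l chi Pm) /\
    (is_trace delta l Pp Xp /\ is_trace delta l Pm Xm) /\
    (is_amplitude Pp amplitude /\ is_amplitude Pm amplitude) /\
    exists bp bm : R,
      is_line Xp speed bp /\ is_line Xm speed bm /\ bp - bm = phase_shift.

Lemma cosh_pos (x : R) : 0 < cosh x.
Proof. unfold cosh; generalize (exp_pos x) (exp_pos (- x)); lra. Qed.

Lemma cosh_sinh_sqr (x : R) : cosh x ^ 2 - sinh x ^ 2 = 1.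
Proof.
assert (H := exp_plus x (- x)); rewrite Rplus_opp_r, exp_0 in H.
unfold cosh, sinh; nra.
Qed.

Lemma is_derive_theta (delta l x : R) (m : Z) :
  is_derive (fun y => 2 * theta delta l y m) x (delta * coth l / 2).
Proof. unfold theta; auto_derive; [easy | field]. Qed.

Lemma is_derive_cosh' (x : R) : is_derive cosh x (sinh x).
Proof. apply is_derive_Reals, derivable_pt_lim_cosh. Qed.

Lemma is_derive_sinh' (x : R) : is_derive sinh x (cosh x).
Proof. apply is_derive_Reals, derivable_pt_lim_sinh. Qed.

Lemma one_soliton_sdsG (delta l : R) : 0 < l ->
  let f := fun x m => cosh (2 * theta delta l x m) in
  nonlocal_sdsG delta (fun x m => one_soliton delta l (theta delta l x m))
    (fun x m => Derive (fun y => f y m) x / f x m).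
Proof.
intros Hl f.
set (k := delta * coth l / 2).
assert (Hsl : 0 < sinh l).
{ unfold sinh; generalize (exp_increasing (- l) l); lra. }
assert (Hf : forall x m, is_derive (fun y => f y m) x
                           (k * sinh (2 * theta delta l x m))).
{ intros x m.
  exact (is_derive_comp cosh _ x _ _ (is_derive_cosh' _)
           (is_derive_theta delta l x m)). }
assert (Hs : forall x m,
  is_derive (fun y => sinh (2 * theta delta l y m)) x
    (k * cosh (2 * theta delta l x m))).
{ intros x m.
  exact (is_derive_comp sinh _ x _ _ (is_derive_sinh' _)
           (is_derive_theta delta l x m)). }
assert (Hp : forall x m, f x m <> 0).
{ intros x m; apply Rgt_not_eq, cosh_pos. }
assert (Hc : forall x m,
  is_derive (fun y => one_soliton delta l (theta delta l y m)) x
    (- k * k * sinh (2 * theta delta l x m) / f x m ^ 2)).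
{ intros x m.
  evar_last.
  - exact (is_derive_scal _ x k _ (is_derive_inv _ x _ (Hf x m) (Hp x m))).
  - unfold f; field; apply Hp. }
assert (Hw : forall x m, Derive (fun y => f y m) x / f x m
                         = k * sinh (2 * theta delta l x m) / f x m).
{ intros x m; apply (f_equal (fun z => z / f x m)).
  exact (is_derive_unique _ _ _ (Hf x m)). }
intros x m; split; [eexists; apply Hc | split].
- apply is_derive_ext with
    (fun y => k * sinh (2 * theta delta l y m) / f y m).
  { intros y; symmetry; apply Hw. }
  evar_last.
  + exact (is_derive_div _ _ x _ _ (is_derive_scal _ x k _ (Hs x m))
             (Hf x m) (Hp x m)).
  + assert (E : 2 * theta delta l (- x) (- m) = - (2 * theta delta l x m)).
    { unfold theta; rewrite opp_IZR; ring. }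
    assert (Ec : forall u, cosh (- u) = cosh u).
    { intros u; unfold cosh; rewrite Ropp_involutive; field. }
    unfold one_soliton; rewrite E, Ec; fold k.
    generalize (Hp x m) (cosh_sinh_sqr (2 * theta delta l x m)).
    unfold f; intros H1 H2; apply (Rmult_eq_reg_r (cosh (2 * theta delta l x m) ^ 2)).
    2: now apply pow_nonzero.
    field_simplify; [nra | easy | easy].
- assert (Hc' : forall j,
    Derive (fun y => one_soliton delta l (theta delta l y j)) x
    = - k * k * sinh (2 * theta delta l x j) / f x j ^ 2).
  { intros j; exact (is_derive_unique _ _ _ (Hc x j)). }
  rewrite !Hw, !Hc'.
  generalize (Hp x m) (Hp x (m + 1)%Z); unfold one_soliton, f; fold k.
  replace (2 * theta delta l x (m + 1)) with (2 * theta delta l x m + l + l)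
    by (unfold theta; rewrite plus_IZR; ring).
  replace (2 * theta delta l x m) with (2 * theta delta l x m + l - l) by ring.
  set (v := 2 * theta delta l x m + l).
  replace (v - l + l + l) with (v + l) by ring.
  intros H1 H2.
  assert (E : k * (sinh (v + l) - sinh (v - l)) * 2
              = delta * (cosh (v + l) + cosh (v - l))).
  { replace (sinh (v + l) - sinh (v - l)) with (2 * cosh v * sinh l).
    2: { unfold sinh, cosh, Rminus; rewrite !Ropp_plus_distr, !exp_plus, Ropp_involutive; field. }
    replace (cosh (v + l) + cosh (v - l)) with (2 * cosh v * cosh l).
    2: { unfold cosh, Rminus; rewrite !Ropp_plus_distr, !exp_plus, Ropp_involutive; field. }
    unfold k, coth; field; lra. }
  transitivity
    (k * (k * (sinh (v + l) - sinh (v - l)) * 2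
          - delta * (cosh (v + l) + cosh (v - l)))
     / (cosh (v + l) * cosh (v - l))).
  + field; split; assumption.
  + rewrite E; field; split; assumption.
Qed.

(* Main.v *)
Require Import Defs.
From Stdlib Require Import Reals ZArith Lra Lia.
From Coquelicot Require Import Coquelicot.
Open Scope R_scope.

(** With one phase [t] held fixed, the other phase is affine in [m] with
    nonzero slope and tends to [+oo] or [-oo].  Dividing [g] and [f] by its hyperbolic cosine
    leaves in the limit a constant over
    [A cosh 2t -+ S sinh 2t], where [A = cosh 2l1 cosh 2l2 - 1] and
    [S = sinh 2l1 sinh 2l2].  Since [A + S = 2 sinh^2 (l1 + l2)] and
    [A - S = 2 sinh^2 (l2 - l1)], this is
    [2 sinh (l2 - l1) sinh (l1 + l2) cosh (2t +- L)], so the limit is a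
    one-soliton translated by [-+ L / 2]. *)

(** * Hyperbolic functions *)

Lemma sinh_pos (x : R) : 0 < x -> 0 < sinh x.
Proof. intros Hx; rewrite <- sinh_0; now apply sinh_lt. Qed.

Lemma sinh_minus (x y : R) : sinh (x - y) = sinh x * cosh y - cosh x * sinh y.
Proof.
unfold sinh, cosh, Rminus.
rewrite !Ropp_plus_distr, !exp_plus, Ropp_involutive; field.
Qed.

Lemma sinh_plus (x y : R) : sinh (x + y) = sinh x * cosh y + cosh x * sinh y.
Proof. unfold sinh, cosh; rewrite !Ropp_plus_distr, !exp_plus; field. Qed.

Lemma cosh_plus (x y : R) : cosh (x + y) = cosh x * cosh y + sinh x * sinh y.
Proof. unfold sinh, cosh; rewrite !Ropp_plus_distr, !exp_plus; field. Qed.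

Lemma cosh_0 : cosh 0 = 1.
Proof. unfold cosh; rewrite Ropp_0, exp_0; lra. Qed.

Lemma cosh_opp (x : R) : cosh (- x) = cosh x.
Proof. unfold cosh; rewrite Ropp_involutive; lra. Qed.

Lemma sinh_opp (x : R) : sinh (- x) = - sinh x.
Proof. unfold sinh; rewrite Ropp_involutive; lra. Qed.

Lemma cosh_gt_1 (x : R) : x <> 0 -> 1 < cosh x.
Proof.
intros Hx.
assert (Hs : sinh x <> 0).
{ destruct (Rdichotomy _ _ Hx) as [H | H]; apply sinh_lt in H;
  rewrite sinh_0 in H; lra. }
generalize (cosh_sinh_sqr x) (cosh_pos x) (pow2_gt_0 _ Hs); nra.
Qed.

Lemma coth_pos (x : R) : 0 < x -> 0 < coth x.
Proof. intros Hx; apply Rdiv_lt_0_compat; [apply cosh_pos | now apply sinh_pos]. Qed.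

(** * Limits along the integers and at infinity *)

Instance Z_p_infty_filter : Filter Z_p_infty.
Proof.
split.
- now exists 0%Z.
- intros P Q [N HN] [M HM]; exists (Z.max N M); intros m Hm.
  split; [apply HN | apply HM]; lia.
- intros P Q HPQ [N HN]; exists N; auto.
Qed.

Instance Z_m_infty_filter : Filter Z_m_infty.
Proof.
split.
- now exists 0%Z.
- intros P Q [N HN] [M HM]; exists (Z.min N M); intros m Hm.
  split; [apply HN | apply HM]; lia.
- intros P Q HPQ [N HN]; exists N; auto.
Qed.

Lemma filterlim_affine_Z_p_infty (a b : R) : 0 < a ->
  filterlim (fun m : Z => a * IZR m + b) Z_p_infty (Rbar_locally p_infty).
Proof.
intros Ha P [M HM]; exists (up ((M - b) / a)); intros m Hm.
apply HM; apply IZR_lt in Hm; destruct (archimed ((M - b) / a)) as [H _].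
replace M with (a * ((M - b) / a) + b) by (field; lra); nra.
Qed.

Lemma filterlim_affine_Z_m_infty (a b : R) : a < 0 ->
  filterlim (fun m : Z => a * IZR m + b) Z_m_infty (Rbar_locally p_infty).
Proof.
intros Ha P HP.
(* The reflection [m -> - m] reduces the claim to the limit at [+oo] with slope [- a]. *)
destruct (filterlim_affine_Z_p_infty (- a) b ltac:(lra) P HP) as [N HN].
exists (- N)%Z; intros m Hm.
replace (a * IZR m + b) with (- a * IZR (- m) + b) by (rewrite opp_IZR; ring).
apply HN; lia.
Qed.

(** Multiplying numerator and denominator by [z = exp (- v)] gives a rational function [h] of [z].
    Its denominator at [z = 0] is [(p + r) / 2], so [h] is continuous there and the limit is
    [h 0]. *)
Lemma is_lim_cosh_quotient (a b p q r : R) : p + r <> 0 ->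
  is_lim (fun v => (a * cosh v + b) / (p * cosh v + r * sinh v + q))
    p_infty (a / (p + r)).
Proof.
intros Hpr.
set (h := fun z => (a * (1 + z ^ 2) / 2 + b * z)
                   / (p * (1 + z ^ 2) / 2 + r * (1 - z ^ 2) / 2 + q * z)).
apply is_lim_ext with (fun v => h (exp (- v))).
{ intros v; unfold h, cosh, sinh.
  assert (E : exp v * exp (- v) = 1).
  { rewrite <- exp_plus, Rplus_opp_r; apply exp_0. }
  generalize (exp_pos (- v)); intros Hz.
  set (z := exp (- v)) in *; set (w := exp v) in *.
  rewrite <- (Rdiv_mult_r_r z (a * ((w + z) / 2) + b)) by lra.
  (* Each [1] in [h] becomes [w * z], which leaves polynomial identities in [w] and [z]. *)
  rewrite <- E; f_equal; field. }
replace (a / (p + r)) with (h 0) by (unfold h; field; lra).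
apply (filterlim_comp _ _ _ (fun v => exp (- v)) h _ (locally 0)).
- apply (is_lim_comp exp Ropp p_infty 0 m_infty).
  + apply is_lim_exp_m.
  + apply (is_lim_opp (fun v => v) p_infty p_infty), is_lim_id.
  + now exists 0.
- apply (ex_derive_continuous h); unfold h; auto_derive; nra.
Qed.

(** * The phases when one of them is held fixed *)

Lemma theta_x_of_theta (delta l t : R) (m : Z) : 0 < delta -> 0 < l ->
  theta delta l (x_of_theta delta l t m) m = t.
Proof.
intros Hd Hl; unfold theta, x_of_theta; field.
generalize (coth_pos l Hl); lra.
Qed.

Lemma theta_x_of_theta_other (delta l k t : R) (m : Z) : 0 < delta -> 0 < l ->
  theta delta k (x_of_theta delta l t m) m
  = (k - l * coth k / coth l) * IZR m + coth k / coth l * t.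
Proof.
intros Hd Hl; unfold theta, x_of_theta; field.
generalize (coth_pos l Hl); lra.
Qed.

(** In this form the sign is visible: for [l < k] both summands of the numerator are positive. *)
Lemma relative_slope (l k : R) : 0 < l -> 0 < k ->
  k - l * coth k / coth l
  = (k * sinh (k - l) + (k - l) * (cosh k * sinh l)) / (sinh k * cosh l).
Proof.
intros Hl Hk; rewrite sinh_minus; unfold coth.
generalize (sinh_pos l Hl) (sinh_pos k Hk) (cosh_pos l) (cosh_pos k).
intros; field; lra.
Qed.

Lemma relative_slope_pos (l k : R) : 0 < l -> l < k ->
  0 < k - l * coth k / coth l.
Proof.
intros Hl Hk; rewrite relative_slope by lra.
generalize (sinh_pos l Hl) (sinh_pos k ltac:(lra)) (cosh_pos l) (cosh_pos k)
  (sinh_pos (k - l) ltac:(lra)); intros.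
apply Rdiv_lt_0_compat; [| now apply Rmult_lt_0_compat].
apply Rplus_lt_0_compat; repeat first [lra | apply Rmult_lt_0_compat].
Qed.

Lemma relative_slope_neg (l k : R) : 0 < k -> k < l ->
  k - l * coth k / coth l < 0.
Proof.
intros Hk Hl.
generalize (relative_slope_pos k l Hk Hl) (coth_pos k Hk)
  (coth_pos l ltac:(lra)); intros H Hck Hcl.
(* Exchanging [l] and [k] changes the slope by the negative factor [- (coth k / coth l)]. *)
replace (k - l * coth k / coth l)
  with (- (coth k / coth l * (l - k * coth l / coth k))) by (field; lra).
generalize (Rdiv_lt_0_compat _ _ Hck Hcl); nra.
Qed.

(** * The two-soliton with one phase fixed *)

(** Under the exchange two factors of [g] change sign and [f] is invariant. Hence one limit
    computation serves both solitons. *)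
Lemma two_soliton_sym (delta l k x : R) (m : Z) :
  two_soliton delta l k x m = two_soliton delta k l x m.
Proof.
unfold two_soliton; f_equal; unfold two_soliton_f, two_soliton_g; ring.
Qed.

(** Here [s] is the sign of the infinity approached by the phase of [k]. Since [cosh] is even and
    [sinh] odd, passing to [s] times that phase puts [s] only in front of the product of the [sinh]
    terms. *)
Lemma two_soliton_lim (F : (Z -> Prop) -> Prop) {FF : Filter F}
    (delta l k t s : R) :
  0 < delta -> 0 < l -> s = 1 \/ s = -1 ->
  filterlim (fun m => s * theta delta k (x_of_theta delta l t m) m) F
    (Rbar_locally p_infty) ->
  let d := (csch l * csch k) ^ 2 *
           ((cosh (2 * l) * cosh (2 * k) - 1) * cosh (2 * t)
            - s * (sinh (2 * l) * sinh (2 * k)) * sinh (2 * t)) in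
  d <> 0 ->
  filterlim (fun m => two_soliton delta l k (x_of_theta delta l t m) m) F
    (locally (delta * coth l * (coth l ^ 2 - coth k ^ 2) / d)).
Proof.
intros Hd Hl Hs Hu d Hd0.
set (G := delta * (coth l ^ 2 - coth k ^ 2)).
set (K := (csch l * csch k) ^ 2).
set (p := K * ((cosh (2 * l) * cosh (2 * k) - 1) * cosh (2 * t))).
set (r := - (K * (s * (sinh (2 * l) * sinh (2 * k)) * sinh (2 * t)))).
set (q := - (K * (sinh (2 * l) * sinh (2 * k)))).
assert (Epr : d = p + r) by (unfold d, p, r; fold K; ring).
set (h := fun v => (G * coth l * cosh v + - (G * coth k * cosh (2 * t)))
                   / (p * cosh v + r * sinh v + q)).
apply filterlim_ext with
  (fun m => h (2 * (s * theta delta k (x_of_theta delta l t m) m))).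
{ intros m; unfold two_soliton, two_soliton_g, two_soliton_f.
  rewrite theta_x_of_theta by assumption.
  set (u := theta delta k (x_of_theta delta l t m) m).
  unfold h, p, r, q, G; fold K.
  destruct Hs as [-> | ->].
  - replace (2 * (1 * u)) with (2 * u) by ring; f_equal; ring.
  - replace (2 * (-1 * u)) with (- (2 * u)) by ring.
    rewrite cosh_opp, sinh_opp; f_equal; ring. }
rewrite Epr.
replace (delta * coth l * (coth l ^ 2 - coth k ^ 2)) with (G * coth l)
  by (unfold G; ring).
apply (filterlim_comp _ _ _
  (fun m => s * theta delta k (x_of_theta delta l t m) m)
  (fun v => h (2 * v)) _ (Rbar_locally p_infty)).
{ exact Hu. }
apply (filterlim_comp _ _ _ (fun v => 2 * v) h _ (Rbar_locally p_infty)).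
(* The absolute value covers a negative [M], for which [v > M] would not give [2 * v > M]. *)
- intros P [M HM]; exists (Rabs M); intros v Hv; apply HM.
  generalize (Rle_abs M) (Rabs_pos M); lra.
- apply is_lim_cosh_quotient; now rewrite <- Epr.
Qed.

(** * Closed forms of the limit denominator and of the amplitude *)

(** With [N = 2 * sinh (l2 - l1) * sinh (l1 + l2)], the two coefficients are [N * cosh L] and
    [- N * sinh L], so the addition formula for [cosh] merges the terms. *)
Lemma two_soliton_denominator (l1 l2 s T : R) :
  0 < l1 -> l1 < l2 -> s = 1 \/ s = -1 ->
  (cosh (2 * l1) * cosh (2 * l2) - 1) * cosh T
    - s * (sinh (2 * l1) * sinh (2 * l2)) * sinh T
  = 2 * sinh (l2 - l1) * sinh (l1 + l2)
    * cosh (T + s * ln (sinh (l2 - l1) / sinh (l1 + l2))).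
Proof.
intros H1 H12 Hs.
assert (Ha : 0 < sinh (l2 - l1)) by (apply sinh_pos; lra).
assert (Hb : 0 < sinh (l1 + l2)) by (apply sinh_pos; lra).
set (L := ln (sinh (l2 - l1) / sinh (l1 + l2))).
assert (EL : exp L = sinh (l2 - l1) / sinh (l1 + l2)).
{ apply exp_ln, Rdiv_lt_0_compat; assumption. }
assert (EC : 2 * sinh (l2 - l1) * sinh (l1 + l2) * cosh L
             = sinh (l2 - l1) ^ 2 + sinh (l1 + l2) ^ 2).
{ unfold cosh; rewrite exp_Ropp, EL; field; lra. }
assert (ES : 2 * sinh (l2 - l1) * sinh (l1 + l2) * sinh L
             = sinh (l2 - l1) ^ 2 - sinh (l1 + l2) ^ 2).
(* Only [sinh L] is expanded; the other two [sinh] terms stay atoms for [field]. *)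
{ unfold sinh at 3; rewrite exp_Ropp, EL; field; lra. }
assert (E : cosh (2 * l1) * cosh (2 * l2) - 1
            = sinh (l2 - l1) ^ 2 + sinh (l1 + l2) ^ 2 /\
            sinh (2 * l1) * sinh (2 * l2)
            = sinh (l1 + l2) ^ 2 - sinh (l2 - l1) ^ 2).
{ rewrite sinh_minus, sinh_plus.
  replace (2 * l1) with (l1 + l1) by ring.
  replace (2 * l2) with (l2 + l2) by ring.
  rewrite !cosh_plus, !sinh_plus.
  assert (E1 : cosh l1 ^ 2 = 1 + sinh l1 ^ 2)
    by (generalize (cosh_sinh_sqr l1); lra).
  assert (E2 : cosh l2 ^ 2 = 1 + sinh l2 ^ 2)
    by (generalize (cosh_sinh_sqr l2); lra).
  split; ring_simplify; rewrite ?E1, ?E2; ring. }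
destruct E as [E1 E2]; rewrite E1, E2, <- EC.
replace (sinh (l1 + l2) ^ 2 - sinh (l2 - l1) ^ 2)
  with (- (2 * sinh (l2 - l1) * sinh (l1 + l2) * sinh L))
  by (rewrite ES; ring).
destruct Hs as [-> | ->].
- replace (1 * L) with L by ring; rewrite cosh_plus; ring.
- replace (-1 * L) with (- L) by ring.
  rewrite cosh_plus, cosh_opp, sinh_opp; ring.
Qed.

(** The product of the two [sinh] terms is [sinh l2 ^ 2 * cosh l1 ^ 2 - cosh l2 ^ 2 * sinh l1 ^ 2].
    This identity reduces the amplitudes to plus or minus [delta * coth l / 2], as for a
    one-soliton. *)
Lemma coth_sqr_minus (l1 l2 : R) : 0 < l1 -> 0 < l2 ->
  coth l1 ^ 2 - coth l2 ^ 2
  = (csch l1 * csch l2) ^ 2 * sinh (l2 - l1) * sinh (l1 + l2).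
Proof.
intros H1 H2; rewrite sinh_minus, sinh_plus; unfold coth, csch.
generalize (sinh_pos l1 H1) (sinh_pos l2 H2); intros.
field_simplify_eq; [| lra].
assert (E1 : cosh l1 ^ 2 = 1 + sinh l1 ^ 2)
  by (generalize (cosh_sinh_sqr l1); lra).
assert (E2 : cosh l2 ^ 2 = 1 + sinh l2 ^ 2)
  by (generalize (cosh_sinh_sqr l2); lra).
rewrite E1, E2; ring.
Qed.

Lemma csch_pos (x : R) : 0 < x -> 0 < csch x.
Proof. intros Hx; now apply Rinv_0_lt_compat, sinh_pos. Qed.

(** * Extremum, trace and amplitude of a translated one-soliton *)

Lemma soliton_extremum (delta l e c t0 : R) :
  0 < delta -> 0 < l -> e = 1 \/ e = -1 ->
  is_extremum (fun t => e * one_soliton delta l (t - c)) t0 <-> t0 = c.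
Proof.
intros Hd Hl He.
assert (Hc : is_extremum (fun t => e * one_soliton delta l (t - c)) c).
{ intros t Ht; unfold one_soliton.
  assert (Ea : Rabs e = 1).
  { destruct He as [-> | ->]; unfold Rabs; destruct Rcase_abs; lra. }
  rewrite !Rabs_mult, Ea, !Rmult_1_l.
  replace (2 * (c - c)) with 0 by ring; rewrite cosh_0.
  assert (Hk : 0 < delta * coth l / 2).
  { generalize (coth_pos l Hl); nra. }
  assert (Hch : 1 < cosh (2 * (t - c))) by (apply cosh_gt_1; lra).
  rewrite !Rabs_pos_eq by (apply Rlt_le, Rdiv_lt_0_compat; lra).
  apply Rmult_lt_compat_l; [easy |].
  apply Rinv_lt_contravar; lra. }
split; [| now intros ->].
(* Of two distinct strict maxima of the modulus, each would exceed the other. *)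
intros H; destruct (Req_dec t0 c) as [| N]; [easy |].
generalize (H c (not_eq_sym N)) (Hc t0 N); lra.
Qed.

(** Solving [theta delta l x m = d / 2] for [x] gives the trace; writing the translations as
    [dp / 2] and [dm / 2] produces the prefactor [2 / (delta * coth l)]. *)
Lemma soliton_asymptotics_intro (delta l : R) (chi : R -> Z -> R)
    (e dp dm a v phi : R) :
  0 < delta -> 0 < l -> e = 1 \/ e = -1 ->
  tends_to_profile Z_p_infty delta l chi
    (fun t => e * one_soliton delta l (t - dp / 2)) ->
  tends_to_profile Z_m_infty delta l chi
    (fun t => e * one_soliton delta l (t - dm / 2)) ->
  a = e * (delta * coth l / 2) ->
  v = - (4 * l / (delta * coth l)) ->
  phi = 2 / (delta * coth l) * (dp - dm) ->
  soliton_asymptotics delta l chi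
    (fun m => 2 / (delta * coth l) * (dp - 2 * l * IZR m))
    (fun m => 2 / (delta * coth l) * (dm - 2 * l * IZR m)) a v phi.
Proof.
intros Hd Hl He Hp Hm -> -> ->.
assert (Hcl := coth_pos l Hl).
assert (Htr : forall d, is_trace delta l
  (fun t => e * one_soliton delta l (t - d / 2))
  (fun m => 2 / (delta * coth l) * (d - 2 * l * IZR m))).
{ intros d x m; rewrite soliton_extremum by assumption; unfold theta; split.
  - intros E.
    replace d with (2 * (l * IZR m + delta * coth l / 4 * x)) by lra.
    field; lra.
  - intros ->; field; lra. }
assert (Ham : forall d, is_amplitude
  (fun t => e * one_soliton delta l (t - d / 2)) (e * (delta * coth l / 2))).
{ intros d; exists (d / 2); split; [now apply soliton_extremum |].
  unfold one_soliton; replace (2 * (d / 2 - d / 2)) with 0 by ring.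
  rewrite cosh_0; field. }
exists (fun t => e * one_soliton delta l (t - dp / 2)),
  (fun t => e * one_soliton delta l (t - dm / 2)).
split; [split; [now exists e, (dp / 2) | now exists e, (dm / 2)] |].
do 3 (split; [now split |]).
exists (2 / (delta * coth l) * dp), (2 / (delta * coth l) * dm).
repeat split; try intros m; field; lra.
Qed.

(** The surviving soliton is [l] and the other one is [k], in either order; [Rmin] and [Rmax] fix
    the order inside the logarithm, and the order shows otherwise only in the sign of the
    profile. *)
Lemma two_soliton_profile (F : (Z -> Prop) -> Prop) {FF : Filter F}
    (delta l k s : R) :
  0 < delta -> 0 < l -> 0 < k -> l <> k -> s = 1 \/ s = -1 ->
  (forall t, filterlim
     (fun m => s * theta delta k (x_of_theta delta l t m) m) F
     (Rbar_locally p_infty)) ->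
  let l1 := Rmin l k in
  let l2 := Rmax l k in
  tends_to_profile F delta l (two_soliton delta l k)
    (fun t => sign (k - l) * one_soliton delta l
       (t - (- s * ln (sinh (l2 - l1) / sinh (l1 + l2))) / 2)).
Proof.
intros Hd Hl Hk Hlk Hs Hu l1 l2 t.
set (L := ln (sinh (l2 - l1) / sinh (l1 + l2))).
assert (H1 : 0 < l1) by now apply Rmin_glb_lt.
assert (H12 : l1 < l2).
{ unfold l1, l2, Rmin, Rmax; destruct Rle_dec; lra. }
assert (Hcl := csch_pos l Hl).
assert (Hck := csch_pos k Hk).
assert (Hkl : 0 < (csch l * csch k) ^ 2).
{ now apply pow_lt, Rmult_lt_0_compat. }
assert (Ha : 0 < sinh (l2 - l1)) by (apply sinh_pos; lra).
assert (Hb : 0 < sinh (l1 + l2)) by (apply sinh_pos; lra).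
assert (Hch := cosh_pos (2 * t + s * L)).
set (d := (csch l * csch k) ^ 2 * (2 * sinh (l2 - l1) * sinh (l1 + l2)
           * cosh (2 * t + s * L))).
assert (Ed : (csch l * csch k) ^ 2 *
           ((cosh (2 * l) * cosh (2 * k) - 1) * cosh (2 * t)
            - s * (sinh (2 * l) * sinh (2 * k)) * sinh (2 * t)) = d).
{ unfold d, L; rewrite <- two_soliton_denominator by assumption; f_equal.
  unfold l1, l2, Rmin, Rmax; destruct Rle_dec; ring. }
assert (Hd0 : d <> 0).
{ unfold d; apply Rgt_not_eq; repeat first [lra | apply Rmult_lt_0_compat]. }
replace (sign (k - l) * one_soliton delta l (t - - s * L / 2))
  with (delta * coth l * (coth l ^ 2 - coth k ^ 2) / d).
- rewrite <- Ed; apply two_soliton_lim; auto; now rewrite Ed.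
- unfold one_soliton, d.
  replace (2 * (t - - s * L / 2)) with (2 * t + s * L) by field.
  rewrite coth_sqr_minus by assumption.
  unfold l1, l2, Rmin, Rmax in *; destruct Rle_dec.
  + rewrite sign_eq_1 by lra; field; lra.
  + rewrite sign_eq_m1 by lra.
    (* For [k < l] the oddness of [sinh] supplies the sign [-1]. *)
    replace (k - l) with (- (l - k)) by ring.
    rewrite sinh_opp, (Rplus_comm l k); field; lra.
Qed.

Theorem theorem6 (l1 l2 delta : R)
    (Hl1 : 0 < l1) (Hl12 : l1 < l2) (Hdelta : 0 < delta) :
  let L := ln (sinh (l2 - l1) / sinh (l1 + l2)) in
  let D := 2 * (csch l1 * csch l2) ^ 2 * sinh (l2 - l1) * sinh (l1 + l2) in
  let chi := two_soliton delta l1 l2 in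
  soliton_asymptotics delta l1 chi
    (fun m => 2 / (delta * coth l1) * (- L - 2 * l1 * IZR m))
    (fun m => 2 / (delta * coth l1) * (L - 2 * l1 * IZR m))
    (delta * coth l1 * (coth l1 ^ 2 - coth l2 ^ 2) / D)
    (- (4 * l1 / (delta * coth l1)))
    (- (4 / (delta * coth l1)) * L)
  /\
  soliton_asymptotics delta l2 chi
    (fun m => 2 / (delta * coth l2) * (L - 2 * l2 * IZR m))
    (fun m => 2 / (delta * coth l2) * (- L - 2 * l2 * IZR m))
    (delta * coth l2 * (coth l2 ^ 2 - coth l1 ^ 2) / D)
    (- (4 * l2 / (delta * coth l2)))
    (4 / (delta * coth l2) * L).
Proof.
intros L D chi.
assert (Hl2 : 0 < l2) by lra.
assert (Hc1 := coth_pos l1 Hl1).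
assert (Hc2 := coth_pos l2 Hl2).
assert (ED : coth l1 ^ 2 - coth l2 ^ 2 = D / 2).
{ rewrite coth_sqr_minus by assumption; unfold D; field. }
assert (HD : 0 < D).
{ assert (H := Rmult_lt_0_compat _ _ (csch_pos l1 Hl1) (csch_pos l2 Hl2)).
  generalize (pow_lt _ 2 H) (sinh_pos (l2 - l1) ltac:(lra))
    (sinh_pos (l1 + l2) ltac:(lra)); intros.
  unfold D; repeat first [lra | apply Rmult_lt_0_compat]. }
assert (Hpos := relative_slope_pos l1 l2 Hl1 Hl12).
assert (Hneg := relative_slope_neg l2 l1 Hl1 Hl12).
assert (Hu : forall l k s t m, 0 < l ->
  (s * (k - l * coth k / coth l)) * IZR m + s * (coth k / coth l * t)
  = s * theta delta k (x_of_theta delta l t m) m).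
{ intros l k s t m H; rewrite theta_x_of_theta_other by assumption; ring. }
assert (Hp : forall l k s, 0 < l -> 0 < s * (k - l * coth k / coth l) ->
  forall t, filterlim (fun m => s * theta delta k (x_of_theta delta l t m) m)
    Z_p_infty (Rbar_locally p_infty)).
{ intros l k s H Hs t; eapply filterlim_ext.
  - intros m; now apply Hu.
  - now apply filterlim_affine_Z_p_infty. }
assert (Hm : forall l k s, 0 < l -> s * (k - l * coth k / coth l) < 0 ->
  forall t, filterlim (fun m => s * theta delta k (x_of_theta delta l t m) m)
    Z_m_infty (Rbar_locally p_infty)).
{ intros l k s H Hs t; eapply filterlim_ext.
  - intros m; now apply Hu.
  - now apply filterlim_affine_Z_m_infty. }
assert (Hmin : Rmin l1 l2 = l1) by (apply Rmin_left; lra).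
assert (Hmax : Rmax l1 l2 = l2) by (apply Rmax_right; lra).
(* [T1] and [T2] keep [F] and [s] general, so that each serves both ends. *)
assert (T1 : forall F s (FF : Filter F), s = 1 \/ s = -1 ->
  (forall t, filterlim
     (fun m => s * theta delta l2 (x_of_theta delta l1 t m) m) F
     (Rbar_locally p_infty)) ->
  tends_to_profile F delta l1 chi
    (fun t => 1 * one_soliton delta l1 (t - - s * L / 2))).
{ intros F s FF Hs H.
  generalize (two_soliton_profile F delta l1 l2 s Hdelta Hl1 Hl2 ltac:(lra)
    Hs H); cbv zeta.
  now rewrite Hmin, Hmax, sign_eq_1 by lra. }
assert (T2 : forall F s (FF : Filter F), s = 1 \/ s = -1 ->
  (forall t, filterlim
     (fun m => s * theta delta l1 (x_of_theta delta l2 t m) m) F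
     (Rbar_locally p_infty)) ->
  tends_to_profile F delta l2 chi
    (fun t => -1 * one_soliton delta l2 (t - - s * L / 2))).
{ intros F s FF Hs H.
  generalize (two_soliton_profile F delta l2 l1 s Hdelta Hl2 Hl1 ltac:(lra)
    Hs H); cbv zeta.
  rewrite Rmin_comm, Rmax_comm, Hmin, Hmax, sign_eq_m1 by lra.
  intros HT t; eapply filterlim_ext; [| exact (HT t)].
  intros m; apply two_soliton_sym. }
assert (E1 : - (1) * L = - L) by ring.
assert (E2 : - (-1) * L = L) by ring.
split.
(* The slope of the [l2] phase is positive: it goes to the infinity of the same sign as [m], so
   [s = 1] at [+oo] and [s = -1] at [-oo]. *)
- apply soliton_asymptotics_intro with 1; auto.
  + rewrite <- E1; apply T1; [typeclasses eauto | now left |].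
    apply Hp; lra.
  + rewrite <- E2; apply T1; [typeclasses eauto | now right |].
    apply Hm; lra.
  + rewrite ED; field; lra.
  + field; lra.
(* Now the slope of the [l1] phase is negative, so the values of [s] are exchanged, and with them
   the two traces' shifts. *)
- apply soliton_asymptotics_intro with (-1); auto.
  + rewrite <- E2; apply T2; [typeclasses eauto | now right |].
    apply Hp; lra.
  + rewrite <- E1; apply T2; [typeclasses eauto | now left |].
    apply Hm; lra.
  + replace (coth l2 ^ 2 - coth l1 ^ 2) with (- (D / 2)) by lra; field; lra.
  + field; lra.
Qed.
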